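(* Let $R$ be a complete discrete valuation ring of equal characteristic with maximal ideal $\mathfrak{p}$ and finite residue field $k=R/\mathfrak{p}$ with $|k|>9$, and let $n\ge2$. Let $H$ be a closed subgroup of $\mathrm{GL}_n(R)$ such that $\mathrm{SL}_n(k)\subset H^{[0]}$ and $H^{[1]}$ contains a non-scalar matrix. Then $H^{\mathrm{der}}=\mathrm{SL}_n(R)$.
   Context: $H^{\mathrm{der}}$ denotes the closure (for the topology induced by $R$) of the derived group of $H$. For $i\ge0$, $H^i=\{h\in H:h\equiv\mathrm{Id}_n\bmod\mathfrak{p}^i\}$ and $H^{[i]}=H^i/H^{i+1}$; $H^{[0]}$ is identified with the image of $H$ in $\mathrm{GL}_n(k)$, and for $i>0$, $H^{[i]}$ is identified with a subgroup of $\mathfrak{gl}_n(\mathfrak{p}^i/\mathfrak{p}^{i+1})$ via $[\mathrm{Id}_n+X]\mapsto[X]$. *)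

(* Defs.v *)
From HB Require Import structures.
From mathcomp Require Import all_boot all_order all_algebra.
Set Implicit Arguments. Unset Strict Implicit. Unset Printing Implicit Defensive.
Import GRing.Theory.
Local Open Scope ring_scope.

Definition pmul (R : idomainType) (pi : R) (m : nat) (x : R) : Prop :=
  exists y, x = pi ^+ m * y.

Definition DVR_uniformizer (R : idomainType) (pi : R) : Prop :=
  [/\ pi != 0, pi \notin GRing.unit &
      forall x : R, x != 0 -> exists u m, u \is a GRing.unit /\ x = u * pi ^+ m].

Definition p_complete (R : idomainType) (pi : R) : Prop :=
  forall a : nat -> R, (forall m, pmul pi m (a m.+1 - a m)) ->
    exists l, forall m, pmul pi m (l - a m).

Definition mx_cong (R : idomainType) (pi : R) (n m : nat) (A B : 'M[R]_n) : Prop :=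
  forall i j, pmul pi m (A i j - B i j).

Definition GL_subgroup (R : idomainType) (n : nat) (H : 'M[R]_n -> Prop) : Prop :=
  [/\ H 1%:M, (forall A, H A -> A \in unitmx),
      (forall A B, H A -> H B -> H (A *m B)) & (forall A, H A -> H (invmx A))].

Definition mx_closure (R : idomainType) (pi : R) (n : nat) (H : 'M[R]_n -> Prop)
    (A : 'M[R]_n) : Prop :=
  forall m, exists B, H B /\ mx_cong pi m A B.

Definition mx_closed (R : idomainType) (pi : R) (n : nat) (H : 'M[R]_n -> Prop) : Prop :=
  forall A, mx_closure pi H A -> H A.

Definition mx_comm (R : idomainType) (n : nat) (A B : 'M[R]_n) : 'M[R]_n :=
  invmx A *m invmx B *m A *m B.

Inductive derived_gen (R : idomainType) (n : nat) (H : 'M[R]_n -> Prop) : 'M[R]_n -> Prop :=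
| dg_one : derived_gen H 1%:M
| dg_comm a b : H a -> H b -> derived_gen H (mx_comm a b)
| dg_mul x y : derived_gen H x -> derived_gen H y -> derived_gen H (x *m y)
| dg_inv x : derived_gen H x -> derived_gen H (invmx x).

Definition Hder (R : idomainType) (pi : R) (n : nat) (H : 'M[R]_n -> Prop) : 'M[R]_n -> Prop :=
  mx_closure pi (derived_gen H).

Definition SL_in_H0 (R : idomainType) (k : fieldType) (red : {rmorphism R -> k})
    (n : nat) (H : 'M[R]_n -> Prop) : Prop :=
  forall B : 'M[k]_n, \det B = 1 -> exists A, H A /\ map_mx red A = B.

(* H^[1] = H^1/H^2 (inside gl_n(p/p^2)) contains a non-scalar matrix:
   some h in H with h = Id mod p such that [h - Id] in M_n(p/p^2) is not c*Id for c in p/p^2 *)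
Definition H1_nonscalar (R : idomainType) (pi : R) (n : nat) (H : 'M[R]_n -> Prop) : Prop :=
  exists h, [/\ H h, mx_cong pi 1 h 1%:M &
     ~ (exists c : R, pmul pi 1 c /\ mx_cong pi 2 (h - 1%:M) c%:M)].

(* Main.v *)
Require Import Defs.
From HB Require Import structures.
From mathcomp Require Import all_boot all_order all_algebra.
From mathcomp Require Import fingroup perm ring.
Import GRing.Theory.
Local Open Scope ring_scope.
Set Implicit Arguments. Unset Strict Implicit. Unset Printing Implicit Defensive.

(* Let D be the derived group of H and, for m > 0, let D^[m] be the set of X over k such that
   some 1 + pi^m Y with Y = X mod p lies in D.  Since SL_n(k) is perfect, D maps onto SL_n(k),
   so D^[m] is an additive group stable under conjugation by SL_n(k).  Such a group contains
   sl_n(k) as soon as it contains a nonscalar matrix.  Hence, by successive approximation, D is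
   dense in SL_n(R) if every D^[m] contains a nonscalar matrix.
   For m = 1 this comes from H^[1] by taking a commutator with a torus element.  For m > 1 one
   may assume that D is already dense modulo p^m, and takes the commutator of two elements of D
   approximating suitable A, B in SL_n(R) for which AB - BA is exactly divisible by p^m; the
   errors of approximation do not matter when A = B = 1 mod p.  Elementary matrices serve as
   A and B, except when n = 2 and k has characteristic 2, where [sl_2, sl_2] is scalar.  Then A
   is the diagonal matrix (t, t^-1) with t = 1 + pi^j, and one uses t^2 = 1 + pi^(2j). *)

(** * Elementary and torus matrices *)

Section Elementary.
Variables (R : comUnitRingType) (n : nat).
Implicit Types (i j k l : 'I_n) (X : 'M[R]_n).

Definition elem_mx i j (c : R) : 'M[R]_n := 1%:M + c *: delta_mx i j.

Definition torus_row i j (t : R) : 'rV[R]_n :=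
  \row_l (if l == i then t else if l == j then t^-1 else 1).

Definition torus_mx i j t : 'M[R]_n := diag_mx (torus_row i j t).

Lemma delta_mx_sandwich i j k l X :
  delta_mx i j *m X *m delta_mx k l = X j k *: delta_mx i l.
Proof.
apply/matrixP=> a b; rewrite !mxE (bigD1 k) //= big1 => [|c ck]; last first.
  by rewrite !mxE (negPf ck) /= mulr0.
rewrite addr0 !mxE (bigD1 j) //= big1 => [|c cj]; last first.
  by rewrite !mxE (negPf cj) andbF mul0r.
rewrite addr0 !mxE !eqxx /= andbT.
by case: (a == i); case: (b == l); rewrite ?mulr1 ?mul1r ?mul0r ?mulr0.
Qed.

Lemma delta_mulmxE i j X a b : (delta_mx i j *m X) a b = (X j b) *+ (a == i).
Proof.
rewrite mxE (bigD1 j) //= big1 => [|c cj]; last by rewrite mxE (negPf cj) andbF mul0r.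
by rewrite addr0 !mxE eqxx andbT; case: (a == i); rewrite ?mul1r ?mul0r.
Qed.

Lemma mulmx_deltaE i j X a b : (X *m delta_mx i j) a b = (X a i) *+ (b == j).
Proof.
rewrite mxE (bigD1 i) //= big1 => [|c cj]; last by rewrite mxE (negPf cj) mulr0.
by rewrite addr0 !mxE eqxx /=; case: (b == j); rewrite ?mulr1 ?mulr0.
Qed.

Lemma elem_mx0 i j : elem_mx i j 0 = 1%:M.
Proof. by rewrite /elem_mx scale0r addr0. Qed.

Lemma mul_elem_mx i j k l a b : elem_mx i j a *m elem_mx k l b =
  1%:M + a *: delta_mx i j + b *: delta_mx k l + (a * b) *: (delta_mx i l *+ (j == k)).
Proof.
rewrite /elem_mx mulmxDl mul1mx mulmxDr mulmx1 -scalemxAl -scalemxAr scalerA.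
by rewrite mul_delta_mx_cond; rewrite addrA [1%:M + _ + _]addrAC.
Qed.

Lemma elem_mxD i j a b : i != j -> elem_mx i j a *m elem_mx i j b = elem_mx i j (a + b).
Proof.
by move=> ij; rewrite mul_elem_mx eq_sym (negPf ij) mulr0n scaler0 addr0 -addrA -scalerDl.
Qed.

Lemma elem_mxK i j a : i != j -> elem_mx i j a *m elem_mx i j (- a) = 1%:M.
Proof. by move=> ij; rewrite elem_mxD // subrr elem_mx0. Qed.

Lemma det_elem_mx i j c : i != j -> \det (elem_mx i j c) = 1.
Proof.
move=> ij; have trig (a b : 'I_n) (d : R) : (b < a)%N -> \det (elem_mx a b d) = 1.
  move=> ba; rewrite det_trig; last first.
    apply/is_trig_mxP => x y xy; rewrite !mxE -val_eqE /= (ltn_eqF xy) add0r.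
    case: eqP => [xa|]; last by rewrite mulr0.
    by case: eqP => [yb|]; [subst; move: (ltn_trans xy ba); rewrite ltnn|rewrite mulr0].
  apply: big1 => x _; rewrite !mxE eqxx; case: eqP => [->|]; last by rewrite mulr0 addr0.
  by rewrite -val_eqE /= gtn_eqF // mulr0 addr0.
case: (ltngtP i j) => [lt_ij|/trig //|e]; last by rewrite -val_eqE /= e eqxx in ij.
rewrite -det_tr -(trig j i c) //; congr (\det _).
by rewrite /elem_mx linearD linearZ /= trmx1 trmx_delta.
Qed.

Lemma invmx_unique (A B : 'M[R]_n) : A *m B = 1%:M -> invmx A = B.
Proof. by move=> AB; have [uA _] := mulmx1_unit AB; rewrite -[LHS]mulmx1 -AB mulKmx. Qed.

Lemma invmx_elem_mx i j c : i != j -> invmx (elem_mx i j c) = elem_mx i j (- c).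
Proof. by move=> ij; apply: invmx_unique; rewrite elem_mxK. Qed.

Lemma det_torus_mx i j t : i != j -> t \is a GRing.unit -> \det (torus_mx i j t) = 1.
Proof.
move=> ij tu; rewrite det_diag (bigD1 i) //= (bigD1 j) 1?eq_sym //= big1 => [|l].
  by rewrite !mxE !eqxx [j == i]eq_sym (negPf ij) mulr1 divrr.
by rewrite mxE => /andP[/negPf-> /negPf->].
Qed.

Lemma torus_mx1 i j : torus_mx i j 1 = 1%:M.
Proof.
rewrite /torus_mx -diag_const_mx; congr diag_mx; apply/rowP => l; rewrite !mxE invr1.
by case: ifP => // _; case: ifP.
Qed.

Lemma torus_rowV i j t : i != j -> t \is a GRing.unit ->
  forall l, torus_row i j t 0 l * torus_row i j t^-1 0 l = 1.
Proof.
move=> ij tu l; rewrite !mxE; case: eqP => _; first by rewrite divrr.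
by case: eqP => _; rewrite ?invrK ?mulVr ?mulr1.
Qed.

Lemma torus_mxK i j t : i != j -> t \is a GRing.unit ->
  torus_mx i j t *m torus_mx i j t^-1 = 1%:M.
Proof.
move=> ij tu; rewrite mulmx_diag -diag_const_mx; congr diag_mx.
by apply/rowP=> l; rewrite [LHS]mxE torus_rowV ?mxE.
Qed.

Lemma invmx_torus_mx i j t : i != j -> t \is a GRing.unit ->
  invmx (torus_mx i j t) = torus_mx i j t^-1.
Proof. by move=> ij tu; apply: invmx_unique; rewrite torus_mxK. Qed.

Lemma torus_conjE i j t X a b : i != j -> t \is a GRing.unit ->
  (torus_mx i j t *m X *m invmx (torus_mx i j t)) a b =
  torus_row i j t 0 a * X a b * torus_row i j t^-1 0 b.
Proof. by move=> ij tu; rewrite invmx_torus_mx // mul_mx_diag mxE mul_diag_mx mxE. Qed.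

(** Conjugation by the torus element multiplies the coefficient of E_ij by t^2. The factor is split
    between the two sides, which suits the product form of a commutator. *)
Lemma torus_elem_mx i j t b : i != j -> t \is a GRing.unit ->
  torus_mx i j t *m elem_mx i j (b * t^-1) = elem_mx i j (b * t) *m torus_mx i j t.
Proof.
move=> ij tu; rewrite mulmxDr mulmxDl mulmx1 mul1mx; congr (_ + _).
apply/matrixP => x y; rewrite mul_diag_mx mul_mx_diag !mxE.
case: (altP (x =P i)) => [_|_] /=; last by rewrite !mulr0 mul0r.
case: (altP (y =P j)) => [->|_] /=; last by rewrite !mulr0 mul0r.
by rewrite [j == i]eq_sym (negPf ij) !mulr1 mulrCA divrr ?mulrK ?mulr1.
Qed.

End Elementary.

(** * Generation of SL_n by elementary matrices *)

Section Generation.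
Variable k : fieldType.

Lemma block_elem_mx n (i j : 'I_n) (c : k) :
  block_mx 1%:M 0 0 (elem_mx i j c) = elem_mx (rshift 1 i) (rshift 1 j) c.
Proof.
apply/matrixP => a b.
case: (split_ordP a) => a' ->; case: (split_ordP b) => b' ->;
  rewrite !(block_mxEul, block_mxEur, block_mxEdl, block_mxEdr) !mxE;
  by rewrite ?eq_lshift ?eq_rshift ?eq_lrshift ?eq_rlshift /= ?andbF ?mulr0 ?addr0.
Qed.

(** Gaussian elimination, by induction on the dimension. It is phrased as an induction principle, so
    that it applies to any multiplicative property of matrices over k. *)
Lemma SL_elementary_ind n (G : 'M[k]_n -> Prop) :
    G 1%:M -> (forall A B, G A -> G B -> G (A *m B)) ->
    (forall i j c, i != j -> G (elem_mx i j c)) ->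
  forall A, \det A = 1 -> G A.
Proof.
elim: n => [|n IHn] in G * => G1 GM GE A detA.
  by have -> : A = 1%:M by apply/matrixP => -[].
have GV i j c B : i != j -> G (elem_mx i j c *m B) -> G B.
  move=> ij GB; rewrite -[B]mul1mx -(elem_mxK (- c) ij) opprK -mulmxA.
  by apply: GM => //; apply: GE.
have elE i j c (B : 'M[k]_n.+1) a b :
    (elem_mx i j c *m B) a b = B a b + c * B j b *+ (a == i).
  by rewrite mulmxDl mul1mx -scalemxAl mxE [in X in _ + X]mxE delta_mulmxE mulrnAr.
(* the Schur complement of a corner entry equal to 1 reduces the dimension *)
have corner (B : 'M[k]_n.+1) : B 0 0 = 1 -> \det B = 1 -> G B.
  move=> B00 detB.
  pose v : 'rV[k]_n := ursubmx (B : 'M_(1 + n)); pose w : 'cV[k]_n := dlsubmx (B : 'M_(1 + n)).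
  pose S : 'M[k]_n := drsubmx (B : 'M_(1 + n)) - w *m v.
  have eB : B = (block_mx 1%:M 0 w 1%:M : 'M_(1 + n)) *m
      (block_mx 1%:M 0 0 S : 'M_(1 + n)) *m (block_mx 1%:M v 0 1%:M : 'M_(1 + n)).
    rewrite !mulmx_block !(mul1mx, mulmx1, mulmx0, mul0mx, addr0, add0r).
    rewrite [w *m v + _]addrC subrK -[LHS](@submxK _ 1 n 1 n).
    have -> // : ulsubmx (B : 'M_(1 + n)) = 1%:M.
    by apply/matrixP=> x y; rewrite !ord1 !mxE -[1]B00; congr (B _ _); apply/val_inj.
  have detS : \det S = 1.
    have lblock (w' : 'cV[k]_n) (T : 'M[k]_n) : \det (block_mx 1%:M 0 w' T : 'M_(1 + n)) = \det T.
      by rewrite det_lblock det1 mul1r.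
    have ublock : \det (block_mx 1%:M v 0 1%:M : 'M_(1 + n)) = 1.
      by rewrite det_ublock !det1 mul1r.
    by rewrite -detB eB !det_mulmx !lblock ublock det1 mul1r mulr1.
  have GS : G (block_mx 1%:M 0 0 S : 'M_(1 + n)).
    apply: (IHn (fun S : 'M[k]_n => G (block_mx 1%:M 0 0 S : 'M_(1 + n)))) => //.
    - by rewrite -scalar_mx_block.
    - move=> X Y GX GY.
      suff -> : block_mx 1%:M 0 0 (X *m Y) =
          block_mx 1%:M 0 0 X *m block_mx 1%:M 0 0 Y :> 'M[k]_(1 + n) by exact: GM.
      by rewrite mulmx_block !(mul1mx, mulmx1, mulmx0, mul0mx, addr0, add0r).
    - by move=> i j c ij; rewrite block_elem_mx; apply: GE; rewrite (inj_eq (@rshift_inj 1 n)).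
  (* The unipotent block factors are products of elementary matrices, one for each entry of the
     column or row. *)
  have Glow (x : 'cV[k]_n) : G (block_mx 1%:M 0 x 1%:M : 'M_(1 + n)).
    rewrite [x]matrix_sum_delta; elim/big_rec: _ => [|i y _ Gy].
      by rewrite -scalar_mx_block.
    have -> : block_mx 1%:M 0 (\sum_(j < 1) x i j *: delta_mx i j + y) 1%:M =
        (elem_mx (rshift 1 i) (lshift n 0) (x i 0) : 'M_(1 + n)) *m
        block_mx 1%:M 0 y 1%:M :> 'M_(1 + n).
      have -> : elem_mx (rshift 1 i) (lshift n 0) (x i 0) =
          block_mx 1%:M 0 (x i 0 *: delta_mx i 0) 1%:M :> 'M_(1 + n).
        apply/matrixP => a b.
        case: (split_ordP a) => a' ->; case: (split_ordP b) => b' ->;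
          rewrite !(block_mxEul, block_mxEur, block_mxEdl, block_mxEdr) !mxE;
          by rewrite ?eq_lshift ?eq_rshift ?eq_lrshift ?eq_rlshift /= ?andbF ?mulr0
            ?addr0 ?add0r ?ord1.
      by rewrite mulmx_block !(mul1mx, mulmx1, mulmx0, mul0mx, addr0, add0r) big_ord1.
    by apply: GM => //; apply: GE.
  have Gup (x : 'rV[k]_n) : G (block_mx 1%:M x 0 1%:M : 'M_(1 + n)).
    rewrite [x]matrix_sum_delta big_ord1; elim/big_rec: _ => [|i y _ Gy].
      by rewrite -scalar_mx_block.
    have -> : block_mx 1%:M (x 0 i *: delta_mx 0 i + y) 0 1%:M =
        block_mx 1%:M y 0 1%:M *m
        (elem_mx (lshift n 0) (rshift 1 i) (x 0 i) : 'M_(1 + n)) :> 'M_(1 + n).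
      have -> : elem_mx (lshift n 0) (rshift 1 i) (x 0 i) =
          block_mx 1%:M (x 0 i *: delta_mx 0 i) 0 1%:M :> 'M_(1 + n).
        apply/matrixP => a b.
        case: (split_ordP a) => a' ->; case: (split_ordP b) => b' ->;
          rewrite !(block_mxEul, block_mxEur, block_mxEdl, block_mxEdr) !mxE;
          by rewrite ?eq_lshift ?eq_rshift ?eq_lrshift ?eq_rlshift /= ?andbF ?mulr0
            ?addr0 ?add0r ?ord1.
      by rewrite mulmx_block !(mul1mx, mulmx1, mulmx0, mul0mx, addr0, add0r).
    by apply: GM => //; apply: GE.
  by rewrite eB; apply: (GM _ _ (GM _ _ _ _)).
(* Adding a multiple of row i to row 0 makes the corner 1. *)
have below (B : 'M[k]_n.+1) i : i != 0 -> B i 0 != 0 -> \det B = 1 -> G B.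
  move=> i0 Bi0 detB; apply: (GV 0 i ((1 - B 0 0) / B i 0)); first by rewrite eq_sym.
  apply: corner; last by rewrite det_mulmx det_elem_mx ?mul1r // eq_sym.
  by rewrite elE eqxx mulr1n divfK // addrC subrK.
have [i /andP[i0 Bi0]|col0] := pickP (fun i => (i != 0) && (A i 0 != 0)).
  exact: below Bi0 detA.
have A0 i : i != 0 -> A i 0 = 0.
  by move=> i0; have := col0 i; rewrite i0 /= => /negbFE/eqP.
(* In dimension 1 the corner is the determinant. *)
have [i1 i1_neq0|only0] := pickP (fun i : 'I_n.+1 => i != 0); last first.
  have eq0 (i : 'I_n.+1) : i = 0 by have /negbFE/eqP := only0 i.
  apply: corner => //; rewrite -detA det_trig; last first.
    by apply/is_trig_mxP => i j; rewrite [i]eq0 [j]eq0 ltnn.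
  by rewrite (bigD1 0) //= big1 ?mulr1 // => i; rewrite only0.
have A00 : A 0 0 != 0.
  apply/eqP => A00; have /eqP := detA; rewrite (expand_det_col _ 0) big1.
    by rewrite eq_sym oner_eq0.
  by move=> i _; case: (eqVneq i 0) => [->|/A0->]; rewrite ?A00 mul0r.
(* Column 0 vanishes outside the corner, so adding row 0 to row i1 copies the corner below
   itself. *)
apply: (GV i1 0 1) => //; apply: (below _ i1) => //.
  by rewrite elE eqxx mul1r A0 // add0r.
by rewrite det_mulmx detA det_elem_mx ?mulr1.
Qed.

End Generation.

(** * Facts on finite sets and finite fields *)

Lemma exists_notin (T : finType) (s : seq T) : (size s < #|T|)%N -> exists x, x \notin s.
Proof.
move=> lt_s; have [x xs|all_s] := pickP (fun x => x \notin s); first by exists x.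
suff : (#|T| <= size s)%N by rewrite leqNgt lt_s.
apply: leq_trans (card_size s); apply/subset_leq_card/subsetP => x _.
exact/negbFE/all_s.
Qed.

(** Squaring is injective, hence onto, in characteristic 2; otherwise every element is a difference
    of two squares. This is needed because the torus acts on E_ij through squares only. *)
Lemma finField_square_span (k : finFieldType) (P : k -> Prop) :
  (forall x, P (x ^+ 2)) -> (forall x y, P x -> P y -> P (x - y)) -> forall x, P x.
Proof.
move=> P2 PB x; have [k2|k2] := eqVneq (2%:R : k) 0.
  have inj2 : injective (fun y : k => y ^+ 2).
    move=> y z /eqP; rewrite eqf_sqr => /orP[] /eqP // ->.
    by apply/eqP; rewrite eq_sym -addr_eq0 -mulr2n -mulr_natl k2 mul0r.
  by have /codomP[y ->] := injF_onto inj2 x.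
have -> : x = ((x + 1) / 2%:R) ^+ 2 - ((x - 1) / 2%:R) ^+ 2 by field.
exact: PB.
Qed.

(** * Additive groups of matrices stable under SL_n *)

Section StableSubgroup.
Variables (k : finFieldType) (n : nat) (M : 'M[k]_n -> Prop).
Hypotheses (card_k : (3 < #|k|)%N)
  (MD : forall X Y, M X -> M Y -> M (X + Y)) (MN : forall X, M X -> M (- X))
  (MJ : forall g X, \det g = 1 -> M X -> M (g *m X *m invmx g)).
Implicit Types (i j l : 'I_n) (X : 'M[k]_n).

Let MB X Y : M X -> M Y -> M (X - Y).
Proof. by move=> MX MY; apply: MD MX (MN MY). Qed.

Lemma exists_torus_param : exists t : k, t != 0 /\ t ^+ 2 != 1.
Proof.
have [t] := @exists_notin k [:: 0; 1; -1] card_k.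
rewrite !inE !negb_or => /and3P[t0 t1 tN1]; exists t; split=> //.
by rewrite sqrf_eq1 negb_or t1.
Qed.

(** Since E^2 = 0, conjugating X by 1 + sE gives X + s(EX - XE) - s^2 EXE, and EXE = X_ji E. The
    quadratic term matters: for n = 2 in characteristic 2, the span of 1 and E_ij is stable under
    brackets with sl_2. *)
Lemma stable_elem i j s X (E := delta_mx i j) : i != j -> M X ->
  M (s *: (E *m X - X *m E) - (s ^+ 2 * X j i) *: E).
Proof.
move=> ij MX; have := MB (MJ (det_elem_mx s ij) MX) MX.
rewrite invmx_elem_mx // /elem_mx -/E; congr M.
rewrite mulmxDl mul1mx mulmxDr mulmx1 scaleNr mulmxN mulmxDl.
rewrite -!scalemxAl -!scalemxAr delta_mx_sandwich -/E scalerBr !scalerA -expr2.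
by rewrite opprD addrC !addrA addNr add0r.
Qed.

(** If X is diagonal with X_ii different from X_jj, conjugation by 1 + E_ji creates the off-diagonal
    entry X_ii - X_jj. *)
Lemma stable_offdiag X : M X -> ~ (exists c, X = c%:M) ->
  exists Y i j, [/\ M Y, i != j & Y j i != 0].
Proof.
move=> MX nsX.
have [[i j] /= /andP[ij Xji]|diagX] :=
    pickP (fun p : 'I_n * 'I_n => (p.1 != p.2) && (X p.2 p.1 != 0)).
  by exists X, i, j.
have X0 i j : i != j -> X j i = 0.
  by move=> ij; have := diagX (i, j); rewrite /= ij => /negbFE/eqP.
have [[i j] /= Xij|eqX] := pickP (fun p : 'I_n * 'I_n => X p.1 p.1 != X p.2 p.2).
  have ij : i != j by apply: contraNneq Xij => ->.
  have ji : j != i by rewrite eq_sym.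
  have MY := stable_elem 1 ji MX; eexists _, i, j; split; [exact: MY | by [] |].
  rewrite !(delta_mulmxE, mulmx_deltaE, mxE) !eqxx (X0 j i) //.
  by rewrite mulr0 mul0r subr0 mul1r subr_eq0.
case: nsX; case: (pickP (fun i : 'I_n => true)) => [i _|n0]; last first.
  by exists 0; apply/matrixP => i; have := n0 i.
exists (X i i); apply/matrixP => a b; rewrite mxE; case: eqVneq => [->|ab].
  by rewrite mulr1n; have /negbFE/eqP := eqX (b, i).
by rewrite mulr0n X0 // eq_sym.
Qed.

(* With ad(N) := (conjugation by 1 + N) - 1: if there is a third index l, then
   ad(E_il) ad(E_lj) ad(E_ij) X = - X_ji E_ij.  Otherwise n = 2, ad(s E_ij) X is upper
   triangular, and the difference with its conjugate by a torus element is supported at (i, j). *)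
Lemma stable_delta X i j : M X -> i != j -> X j i != 0 ->
  exists c, c != 0 /\ M (c *: delta_mx i j).
Proof.
move=> MX ij Xji.
have [l /andP[li lj]|only_ij] := pickP (fun l => (l != i) && (l != j)).
  exists (- X j i); split; first by rewrite oppr_eq0.
  have := stable_elem 1 (_ : i != l) (stable_elem 1 lj (stable_elem 1 ij MX)).
  rewrite eq_sym li => /(_ isT); congr M; apply/matrixP => a b.
  rewrite !(delta_mulmxE, mulmx_deltaE, mxE) !eqxx.
  rewrite (negPf ij) (negPf li) (negPf lj) [j == i]eq_sym (negPf ij) !mulr0n.
  by case: (a == i); case: (b == j); case: (a == l); case: (b == l);
    rewrite /= ?mulr1n ?mulr0n; ring.
have /andP [ij' ji'] : (i != j) && (j != i) by rewrite ij eq_sym ij.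
have only l : l = i \/ l = j.
  have := only_ij l; case: eqVneq => [|_]; first by left.
  by move=> /negbFE/eqP; right.
(* The (i, j) entry of ad(s E_ij) X is s (X_jj - X_ii) - s^2 X_ji; s avoids its two roots. *)
have [s] := @exists_notin k [:: 0; (X j j - X i i) / X j i] (ltnW card_k).
rewrite !inE negb_or => /andP[s0 sX].
have [t [t0 t1]] := exists_torus_param.
have tu : t \is a GRing.unit by rewrite unitfE.
exists ((t ^+ 2 - 1) * (s * (X j j - X i i) - s ^+ 2 * X j i)); split.
  rewrite mulf_neq0 ?subr_eq0 // expr2 -mulrA (inj_eq (mulfI s0)) eq_sym.
  by apply: contraNneq sX => <-; rewrite mulfK.
have MY := stable_elem s ij MX.
have := MB (MJ (det_torus_mx ij tu) MY) MY; congr M; apply/matrixP=> a b.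
rewrite [LHS]mxE torus_conjE // !(delta_mulmxE, mulmx_deltaE, mxE).
case: (only a) => ->; case: (only b) => ->;
  rewrite !eqxx ?(negPf ij) ?(negPf ji') /= ?mulr1n ?mulr0n ?invrK;
  field; rewrite ?t0 //.
Qed.

(** Torus conjugation multiplies c E_ij by every nonzero square, and differences of squares fill
    k. *)
Lemma stable_delta_scale c i j : c != 0 -> i != j -> M (c *: delta_mx i j) ->
  forall d, M (d *: delta_mx i j).
Proof.
move=> c0 ij Mc d; rewrite -[d](divfK c0); move: (d / c).
apply: finField_square_span => [t|x y Mx My]; last first.
  by rewrite mulrBl scalerBl; apply: MB.
have [->|t0] := eqVneq t 0.
  by rewrite expr0n /= mul0r scale0r -(subrr (c *: delta_mx i j)); apply: MB.
have tu : t \is a GRing.unit by rewrite unitfE.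
have := MJ (det_torus_mx ij tu) Mc; congr M; apply/matrixP => a b.
rewrite torus_conjE // !mxE invrK.
case: (eqVneq a i) => [_|]; last by rewrite /= !mulr0 mul0r.
case: (eqVneq b j) => [->|]; last by rewrite /= !mulr0 mul0r.
by rewrite eq_sym (negPf ij) /= ?mulr1; ring.
Qed.

(** Conjugation by elementary matrices changes one index of E_xy at a time ([comm1], [comm2]);
    [swap] exchanges the two indices, which is all there is to do when n = 2. *)
Lemma stable_all_delta i j : i != j -> (forall c, M (c *: delta_mx i j)) ->
  forall a b, a != b -> forall c, M (c *: delta_mx a b).
Proof.
move=> ij Mij.
have comm1 x y l : x != y -> x != l -> (forall c, M (c *: delta_mx x y)) ->
    forall c, M (c *: delta_mx x l).
  move=> xy xl Mxy c; have [<-//|yl] := eqVneq y l.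
  have := stable_elem 1 yl (Mxy (- c)); congr M; apply/matrixP=> a b.
  rewrite !(delta_mulmxE, mulmx_deltaE, mxE) !eqxx [l == x]eq_sym (negPf xl).
  by case: (a == x); case: (a == y); case: (b == y); case: (b == l);
     rewrite /= ?mulr1n ?mulr0n; ring.
have comm2 x y l : x != y -> l != y -> (forall c, M (c *: delta_mx x y)) ->
    forall c, M (c *: delta_mx l y).
  move=> xy ly Mxy c; have [->//|xl] := eqVneq l x.
  have := stable_elem 1 xl (Mxy c); congr M; apply/matrixP=> a b.
  rewrite !(delta_mulmxE, mulmx_deltaE, mxE) !eqxx (negPf ly).
  by case: (a == x); case: (a == l); case: (b == y); case: (b == x);
     rewrite /= ?mulr1n ?mulr0n; ring.
have swap x y : x != y -> (forall c, M (c *: delta_mx x y)) ->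
    forall c, M (c *: delta_mx y x).
  move=> xy Mxy; have yx : y != x by rewrite eq_sym.
  have [t [t0 t1]] := exists_torus_param.
  have t1' : 1 - t != 0.
    by rewrite subr_eq0; apply: contraNneq t1 => <-; rewrite expr1n.
  apply: (@stable_delta_scale (1 - t)) => //.
  (* Conjugating t^-1 E_xy by 1 + t E_yx adds E_yy - E_xx - t E_yx. The diagonal part does not
     depend on t, so comparison with t = 1 leaves (1 - t) E_yx. *)
  have := MB (stable_elem t yx (Mxy (t^-1))) (stable_elem 1 yx (Mxy 1)).
  congr M; apply/matrixP=> a b.
  rewrite !(delta_mulmxE, mulmx_deltaE, mxE) !eqxx.
  by case: (a == x); case: (a == y); case: (b == y); case: (b == x);
     rewrite /= ?mulr1n ?mulr0n; field.
move=> a b ab; have [bi|bi] := eqVneq b i.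
  by subst b; apply: comm2 (swap _ _ ij Mij); rewrite // eq_sym.
by apply: (comm2 i b) => //; rewrite 1?eq_sym //; apply: (comm1 i j); rewrite // eq_sym.
Qed.

(** Conjugating -c E_ij by 1 + E_ji adds c (E_ii - E_jj) + c E_ji, and the last term already lies in
    M. *)
Lemma stable_diag i j c : i != j -> (forall c, M (c *: delta_mx i j)) ->
  M (c *: (delta_mx i i - delta_mx j j)).
Proof.
move=> ij Mij; have ji : j != i by rewrite eq_sym.
have MY := stable_elem 1 ji (Mij (- c)).
have := MD MY (stable_all_delta ij Mij ji (- c)).
congr M; apply/matrixP=> a b.
rewrite !(delta_mulmxE, mulmx_deltaE, mxE) !eqxx.
by case: (a == i); case: (a == j); case: (b == i); case: (b == j);
   rewrite /= ?mulr1n ?mulr0n; ring.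
Qed.

Theorem stable_nonscalar_sl X Y : M X -> ~ (exists c, X = c%:M) -> \tr Y = 0 -> M Y.
Proof.
move=> MX nsX trY.
have [X' [i [j [MX' ij X'ji]]]] := stable_offdiag MX nsX.
have [c [c0 Mc]] := stable_delta MX' ij X'ji.
have Mij := stable_all_delta ij (stable_delta_scale c0 ij Mc).
have M0 : M 0 by rewrite -(subrr X); apply: MB.
have Msum (I : finType) (F : I -> 'M[k]_n) : (forall x, M (F x)) -> M (\sum_x F x).
  by move=> MF; elim/big_rec: _ => // x Z _; apply: MD.
(* Subtracting E_ii from every E_aa changes Y by tr(Y) E_ii, which is zero. *)
have -> : Y = \sum_a \sum_b (if a == b then Y a a *: (delta_mx a a - delta_mx i i)
                              else Y a b *: delta_mx a b).
  transitivity (Y - (\tr Y) *: delta_mx i i); first by rewrite trY scale0r subr0.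
  rewrite {1}[Y]matrix_sum_delta /mxtrace scaler_suml -sumrB.
  apply: eq_bigr => a _; rewrite (bigD1 a) //= [RHS](bigD1 a) //= eqxx.
  rewrite scalerBr addrAC; congr (_ + _); apply: eq_bigr => b.
  by rewrite eq_sym => /negPf ->.
apply/(Msum) => a; apply/(Msum) => b; case: eqVneq => [_|ab]; last exact: (Mij a b ab).
have [->|ai] := eqVneq a i; first by rewrite subrr scaler0.
exact: stable_diag (Mij _ _ ai).
Qed.

End StableSubgroup.

(** In the Leibniz formula a permutation s other than 1 moves some i and also s i, so its term has
    two off-diagonal factors and is divisible by c^2. The identity term supplies 1 + c tr(Y). *)
Lemma det_1_add_scale (R : comNzRingType) n (c : R) (Y : 'M[R]_n) :
  exists z, \det (1%:M + c *: Y) = 1 + c * \tr Y + c ^+ 2 * z.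
Proof.
have diag : exists z, \prod_i (1%:M + c *: Y) i ((1%g : 'S_n) i) =
    1 + c * \tr Y + c ^+ 2 * z.
  rewrite /mxtrace; elim/big_rec2: _ => [|i x y _ [z ->]].
    by exists 0; rewrite !mulr0 !addr0.
  by exists (z + Y i i * x + Y i i * c * z); rewrite perm1 !mxE eqxx mulr1n; ring.
have [z0 diagE] := diag.
have off (s : 'S_n) : s != 1%g ->
    exists z, (-1) ^+ s * \prod_i (1%:M + c *: Y) i (s i) = c ^+ 2 * z.
  move=> s1; have [i si] : exists i, s i != i.
    have [i si|fix_s] := pickP (fun i => s i != i); first by exists i.
    by case/eqP: s1; apply/permP => i; rewrite perm1; have /negbFE/eqP := fix_s i.
  have ssi : s (s i) != s i by rewrite (inj_eq perm_inj).
  rewrite (bigD1 i) //= (bigD1 (s i)) //= !mxE eq_sym (negPf si) eq_sym (negPf ssi).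
  rewrite !mulr0n !add0r; set q := \prod_(_ | _) _.
  by move: (_ ^+ s) => e; exists (e * Y i (s i) * Y (s i) (s (s i)) * q); ring.
rewrite /determinant (bigD1 1%g) //= diagE odd_perm1 mul1r.
suff [z1 ->] : exists z, \sum_(s : 'S_n | s != 1%g)
    (-1) ^+ s * \prod_i (1%:M + c *: Y) i (s i) = c ^+ 2 * z.
  by exists (z0 + z1); rewrite mulrDr addrA.
elim/big_rec: _ => [|s x s1 [z ->]]; first by exists 0; rewrite mulr0.
by have [w ->] := off s s1; exists (w + z); rewrite mulrDr.
Qed.

(** * Graded pieces of the derived group *)

Section Reduction.
Variables (R : idomainType) (pi : R) (k : finFieldType) (red : {rmorphism R -> k}).
Hypotheses (dvr : DVR_uniformizer pi) (red_surj : forall c : k, exists x : R, red x = c)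
  (red_ker : forall x : R, red x = 0 <-> pmul pi 1 x).
Variable n : nat.
Implicit Types (A B X Y Z : 'M[R]_n) (D H : 'M[R]_n -> Prop) (i j l : 'I_n).
Local Notation "A ^r" := (map_mx red A) (at level 2, format "A ^r").

Lemma red_pi : red pi = 0.
Proof. by apply/red_ker; exists 1; rewrite expr1 mulr1. Qed.

Lemma expf_pi_neq0 m : pi ^+ m != 0.
Proof. by case: dvr => pi0 _ _; rewrite expf_neq0. Qed.

Lemma red_unit x : red x != 0 -> x \is a GRing.unit.
Proof.
move=> rx; case: dvr => _ _ /(_ x) []; first by apply: contraNneq rx => ->; rewrite rmorph0.
move=> u [[|m] [uu ex]]; first by rewrite ex expr0 mulr1.
by case/eqP: rx; apply/red_ker; exists (u * pi ^+ m); rewrite ex expr1 exprS mulrCA.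
Qed.

Lemma pmul_eq0 x : (forall m, pmul pi m x) -> x = 0.
Proof.
move=> px; apply/eqP; case: dvr => pi0 piU /(_ x) fx; apply: contraT => /fx[u [m [uu ex]]].
have [y] := px m.+1; rewrite ex mulrC exprSr -mulrA => /(mulfI (expf_pi_neq0 m)) eu.
by move: piU uu; rewrite eu unitrM => /negPf->.
Qed.

Lemma mx_congP m A B : mx_cong pi m A B <-> exists Y, A = B + pi ^+ m *: Y.
Proof.
split=> [AB|[Y ->] i j]; last by exists (Y i j); rewrite !mxE addrAC subrr add0r.
have ex i j : exists y, A i j - B i j == pi ^+ m * y.
  by have [y ->] := AB i j; exists y.
exists (\matrix_(i, j) xchoose (ex i j)); apply/matrixP => i j; rewrite !mxE.
by rewrite -(eqP (xchooseP (ex i j))) addrC subrK.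
Qed.

Lemma map_mx_red_ker Y : Y^r = 0 -> exists Z, Y = pi *: Z.
Proof.
move=> Y0; have /mx_congP [Z] : mx_cong pi 1 Y 0.
  by move=> i j; apply/red_ker; have /matrixP/(_ i j) := Y0; rewrite !mxE subr0.
by rewrite add0r expr1; exists Z.
Qed.

Lemma map_mx_red_scale m Y : (0 < m)%N -> (pi ^+ m *: Y)^r = 0.
Proof. by case: m => // m _; rewrite map_mxZ rmorphXn /= red_pi expr0n scale0r. Qed.

Lemma map_mx_red_inv A : A \in unitmx -> (invmx A)^r = invmx A^r.
Proof.
by move=> uA; apply/esym/invmx_unique; rewrite -map_mxM mulmxV // map_mx1.
Qed.

Lemma map_elem_mx i j c : (elem_mx i j c)^r = elem_mx i j (red c).
Proof. by rewrite /elem_mx map_mxD map_mx1 map_mxZ map_delta_mx. Qed.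

Lemma map_torus_mx i j t : t \is a GRing.unit ->
  (torus_mx i j t)^r = torus_mx i j (red t).
Proof.
move=> tu; rewrite /torus_mx map_diag_mx; congr diag_mx; apply/rowP => l.
by rewrite !mxE; case: ifP => // _; case: ifP => _; rewrite ?rmorphV ?rmorph1.
Qed.

(** This is D^[m], carried from gl_n(p^m/p^(m+1)) to gl_n(k) by dividing by pi^m. *)
Definition level D m (X : 'M[k]_n) := exists Y, D (1%:M + pi ^+ m *: Y) /\ Y^r = X.

(** Products, inverses and conjugates in D give sums, opposites and conjugates of leading terms; the
    corrections vanish mod p because m > 0. An element of SL_n(k) acts through a lift to D. *)
Lemma level_stable D m : GL_subgroup D -> SL_in_H0 red D -> (0 < m)%N ->
  [/\ forall X Y : 'M[k]_n, level D m X -> level D m Y -> level D m (X + Y),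
      forall X : 'M[k]_n, level D m X -> level D m (- X) &
      forall g X : 'M[k]_n, \det g = 1 -> level D m X -> level D m (g *m X *m invmx g)].
Proof.
move=> [D1 DU DM DV] D0 m0.
have h1 Y : (1%:M + pi ^+ m *: Y)^r = 1%:M.
  by rewrite map_mxD map_mx1 map_mx_red_scale // addr0.
split.
- move=> _ _ [X [DX <-]] [Y [DY <-]].
  exists (X + Y *m (1%:M + pi ^+ m *: X)); split; last first.
    by rewrite map_mxD map_mxM h1 mulmx1.
  have := DM _ _ DY DX; congr D.
  by rewrite mulmxDl mul1mx -scalemxAl scalerDr addrA.
- move=> _ [X [DX <-]]; have uX := DU _ DX; set h := 1%:M + _ in DX uX.
  exists (- (X *m invmx h)); split; last first.
    by rewrite map_mxN map_mxM map_mx_red_inv // h1 invmx1 mulmx1.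
  have := DV _ DX; congr D; apply/eqP; rewrite scalerN eq_sym subr_eq eq_sym.
  by rewrite scalemxAl -{1}[invmx h]mul1mx -mulmxDl mulmxV.
- move=> g _ detg [X [DX <-]]; have [G [DG <-]] := D0 g detg.
  exists (G *m X *m invmx G); split; last first.
    by rewrite !map_mxM map_mx_red_inv ?DU.
  have := DM _ _ (DM _ _ DG DX) (DV _ DG); congr D.
  by rewrite mulmxDr mulmx1 mulmxDl mulmxV ?DU // -scalemxAr -scalemxAl.
Qed.

Lemma mulmx_commE A B : A \in unitmx -> B \in unitmx ->
  B *m A *m mx_comm A B = A *m B.
Proof. by move=> uA uB; rewrite /mx_comm -!mulmxA mulKVmx // mulKVmx. Qed.

Lemma derived_gen_sub H A : GL_subgroup H -> derived_gen H A -> H A.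
Proof.
move=> [H1 HU HM HV]; elim=> // [a b Ha Hb|x y _ Hx _ Hy|x _ Hx]; last exact: HV.
  by apply: (HM _ _ (HM _ _ (HM _ _ (HV _ Ha) (HV _ Hb)) Ha) Hb).
exact: HM.
Qed.

Lemma derived_gen_GL H : GL_subgroup H -> GL_subgroup (derived_gen H).
Proof.
move=> HH; split; [exact: dg_one| |exact: dg_mul|exact: dg_inv].
by move=> A /(derived_gen_sub HH); case: HH => _ HU _ _; apply: HU.
Qed.

Lemma derived_gen_det H A : GL_subgroup H -> derived_gen H A -> \det A = 1.
Proof.
move=> [_ HU _ _]; elim=> [|a b /HU ua /HU ub|x y _ dx _ dy|x _ dx].
- by rewrite det1.
- move: ua ub; rewrite !unitmxE /mx_comm !det_mulmx !det_inv => ua ub.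
  by rewrite mulrAC mulrVK ?mulVr.
- by rewrite det_mulmx dx dy mulr1.
- by rewrite det_inv dx invr1.
Qed.

(* The commutator a^-1 b^-1 a b equals 1 + (ba)^-1 (ab - ba). *)
Lemma level_comm H m A B X Y Z : GL_subgroup H -> (0 < m)%N ->
  A *m B - B *m A = pi ^+ m *: Z ->
  H (A + pi ^+ m *: X) -> H (B + pi ^+ m *: Y) ->
  level (derived_gen H) m
    (invmx (B^r *m A^r) *m (Z^r + (A^r *m Y^r - Y^r *m A^r) + (X^r *m B^r - B^r *m X^r))).
Proof.
move=> [_ HU HM _] m0 AB; set a := A + _; set b := B + _ => Ha Hb.
have ua := HU _ Ha; have ub := HU _ Hb; have uba := HU _ (HM _ _ Hb Ha).
(* W is (ab - ba) / pi^m; its last term is divisible by p and disappears on reduction. *)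
pose W := Z + (A *m Y - Y *m A) + (X *m B - B *m X) + pi ^+ m *: (X *m Y - Y *m X).
have abW : a *m b = b *m a + pi ^+ m *: W.
  move/eqP: AB; rewrite subr_eq => /eqP AB.
  rewrite /W /a /b !(mulmxDl, mulmxDr) -!(scalemxAl, scalemxAr) AB.
  move: (B *m A) (A *m Y) (Y *m A) (X *m B) (B *m X) (X *m Y) (Y *m X).
  by move=> M1 M2 M3 M4 M5 M6 M7; apply/matrixP => x y; rewrite !mxE; ring.
have red_a : a^r = A^r by rewrite map_mxD map_mx_red_scale // addr0.
have red_b : b^r = B^r by rewrite map_mxD map_mx_red_scale // addr0.
exists (invmx (b *m a) *m W); split; last first.
  rewrite map_mxM map_mx_red_inv // map_mxM red_a red_b; congr (_ *m _).
  rewrite !(map_mxD, map_mxN, map_mxM) /= [X in _ + X](_ : _ = 0) ?addr0 //.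
  by rewrite map_mx_red_scale.
have := dg_comm Ha Hb; congr (derived_gen H).
rewrite -[LHS](mulKmx uba) mulmx_commE // abW mulmxDr mulVmx //.
by rewrite scalemxAr.
Qed.

(** SL_n(k) is generated by elementary matrices, and each of these is a commutator of an elementary
    matrix and a torus element. Both factors lift to H. *)
Lemma derived_gen_level0 H : (3 < #|k|)%N -> GL_subgroup H -> SL_in_H0 red H ->
  SL_in_H0 red (derived_gen H).
Proof.
move=> card_k HH H0; have [_ HU _ _] := HH.
apply: SL_elementary_ind => [|A B [a [Da <-]] [b [Db <-]]|i j c ij].
- by exists 1%:M; split; [exact: dg_one|rewrite map_mx1].
- by exists (a *m b); split; [exact: dg_mul|rewrite map_mxM].
have [t [t0 t1]] := exists_torus_param card_k.
have tu : t \is a GRing.unit by rewrite unitfE.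
(* b is the solution of b + c = b / t^2, which makes the commutator equal to 1 + c E_ij. *)
pose b := c * t ^+ 2 / (1 - t ^+ 2).
have [u [Hu ru]] := H0 _ (det_elem_mx b ij).
have [T [HT rT]] := H0 _ (det_torus_mx ij tu).
exists (mx_comm u T); split; first exact: dg_comm.
have uu := HU _ Hu; have uT := HU _ HT.
have := mulmx_commE uu uT => /(congr1 (map_mx red)); rewrite !map_mxM ru rT.
have uTu : torus_mx i j t *m elem_mx i j b \in unitmx.
  by rewrite unitmxE det_mulmx det_torus_mx // det_elem_mx // mulr1 unitr1.
move=> e; apply: (can_inj (mulKmx uTu)); rewrite e -mulmxA elem_mxD //.
have -> : b + c = (b / t) * t^-1.
  by rewrite /b; field; rewrite t0 subr_eq0 eq_sym.
by rewrite torus_elem_mx // divfK.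
Qed.

Lemma nonscalar_offdiag (X : 'M[k]_n) i j : i != j -> X i j != 0 ->
  ~ exists c, X = c%:M.
Proof. by move=> ij + [c eX]; rewrite eX mxE (negPf ij) eqxx. Qed.

Lemma level_nonscalar_all D m (X Y : 'M[k]_n) : (3 < #|k|)%N ->
  GL_subgroup D -> SL_in_H0 red D -> (0 < m)%N ->
  level D m X -> ~ (exists c, X = c%:M) -> \tr Y = 0 -> level D m Y.
Proof.
by move=> card_k DG D0 m0; have [MD MN MJ] := level_stable DG D0 m0;
  apply: stable_nonscalar_sl.
Qed.

(** The determinant is 1 + pi^m tr(Y) up to a multiple of pi^(2m); cancelling pi^m leaves tr(Y) in
    p. *)
Lemma level_trace m Y : (0 < m)%N -> \det (1%:M + pi ^+ m *: Y) = 1 -> \tr Y^r = 0.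
Proof.
move=> m0; have [z ->] := det_1_add_scale (pi ^+ m) Y.
rewrite -addrA -[RHS]addr0 => /addrI; rewrite expr2 -mulrA -mulrDr => /eqP.
rewrite mulf_eq0 (negPf (expf_pi_neq0 m)) /= trace_map_mx addr_eq0 => /eqP ->.
by rewrite rmorphN rmorphM rmorphXn /= red_pi expr0n -[m == 0]negbK -lt0n m0 mul0r oppr0.
Qed.

Lemma H1_nonscalar_level H : H1_nonscalar pi H ->
  exists X : 'M[k]_n, level H 1 X /\ ~ exists c, X = c%:M.
Proof.
move=> [h [Hh /mx_congP [Y eh] nsh]]; exists Y^r; split.
  by exists Y; rewrite -eh.
move=> [c eY]; apply: nsh; have [c' rc'] := red_surj c.
have [Z eZ] : exists Z, Y - c'%:M = pi *: Z.
  by apply: map_mx_red_ker; rewrite map_mxB eY map_scalar_mx rc' subrr.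
exists (pi * c'); split; first by exists c'; rewrite expr1.
apply/mx_congP; exists Z; rewrite eh [1%:M + _]addrC addrK expr1 expr2 -scalerA -eZ.
by rewrite scalerBr scale_scalar_mx addrC subrK.
Qed.

(** H^[1] contains E_ij by stability. The commutator of a lift T of a torus element with 1 + pi E,
    where E reduces to E_ij, has leading term T^-1 E T - E; taking the parameter t^-1 for T makes
    this (t^2 - 1) E_ij. *)
Lemma derived_gen_level1 H i j : i != j -> (3 < #|k|)%N ->
  GL_subgroup H -> SL_in_H0 red H -> H1_nonscalar pi H ->
  exists X : 'M[k]_n, level (derived_gen H) 1 X /\ ~ exists c, X = c%:M.
Proof.
move=> ij card_k HG H0 /H1_nonscalar_level [X [HX nsX]].
have trE : \tr (delta_mx i j : 'M[k]_n) = 0.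
  by apply: big1 => l _; rewrite mxE; case: eqP => // ->; rewrite (negPf ij).
have [E [HE rE]] := level_nonscalar_all card_k HG H0 (ltn0Sn 0) HX nsX trE.
have [t [t0 t1]] := exists_torus_param card_k.
have tu : t \is a GRing.unit by rewrite unitfE.
have tVu : t^-1 \is a GRing.unit by rewrite unitrV.
have [T [HT rT]] := H0 _ (det_torus_mx ij tVu).
have := @level_comm H 1 1%:M T E 0 0 HG isT.
rewrite mul1mx mulmx1 subrr scaler0 => /(_ erefl HE).
rewrite addr0 => /(_ HT); rewrite !map_mx0 map_mx1 mulmx0 mul0mx subrr !add0r.
rewrite mulmx1 rT rE mulmxBr mulKmx ?unitmxE ?det_torus_mx ?unitr1 //.
move=> lev; eexists; split; first exact: lev.
apply: (@nonscalar_offdiag _ i j ij).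
rewrite -(invmx_torus_mx ij tu) invmxK mulmxA mxE torus_conjE // !mxE invrK !eqxx.
by rewrite [j == i]eq_sym (negPf ij) mulr1 -expr2 subr_eq0.
Qed.

(** * Nonscalar elements of the higher graded pieces *)

Definition dense_mod D m :=
  forall A, \det A = 1 -> exists B, D B /\ mx_cong pi m A B.

(** The approximation errors X and Y enter [level_comm] only through brackets with B and A, which
    vanish mod p when A and B reduce to 1. *)
Lemma level_approx H m A B Z : GL_subgroup H -> (0 < m)%N ->
  dense_mod (derived_gen H) m -> A^r = 1%:M -> B^r = 1%:M ->
  \det A = 1 -> \det B = 1 -> A *m B - B *m A = pi ^+ m *: Z ->
  level (derived_gen H) m Z^r.
Proof.
move=> HG m0 dm rA rB dA dB AB.
have [a [/(derived_gen_sub HG) Ha /mx_congP [X eX]]] := dm _ dA.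
have [b [/(derived_gen_sub HG) Hb /mx_congP [Y eY]]] := dm _ dB.
have := @level_comm H m A B (- X) (- Y) Z HG m0 AB.
rewrite {1}eX {1}eY !scalerN !addrK => /(_ Ha Hb).
by rewrite rA rB !mul1mx !mulmx1 !subrr !addr0 invmx1 mul1mx.
Qed.

Lemma elem_mx_lie i j l a b : i != j -> l != j ->
  elem_mx i j a *m elem_mx j l b - elem_mx j l b *m elem_mx i j a =
  (a * b) *: (delta_mx i l - delta_mx j j *+ (l == i)) :> 'M[R]_n.
Proof.
move=> ij lj; rewrite !mul_elem_mx eqxx mulr1n.
apply/matrixP => x y; case: (l == i); rewrite ?mulr1n ?mulr0n !mxE; ring.
Qed.

Lemma torus_elem_lie i j t b : i != j ->
  torus_mx i j t *m elem_mx i j b - elem_mx i j b *m torus_mx i j t =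
  (b * (t - t^-1)) *: delta_mx i j :> 'M[R]_n.
Proof.
move=> ij; rewrite mulmxDl mulmxDr mul1mx mulmx1 opprD addrACA subrr add0r.
apply/matrixP => x y; rewrite mxE mul_diag_mx mul_mx_diag !mxE.
case: (eqVneq x i) => [_|_]; last by rewrite /=; ring.
case: (eqVneq y j) => [->|_]; last by rewrite /=; ring.
by rewrite eq_sym (negPf ij) /=; ring.
Qed.

Lemma map_1_add_pi m : (0 < m)%N -> red (1 + pi ^+ m) = 1.
Proof.
by case: m => // m _; rewrite rmorphD rmorph1 rmorphXn /= red_pi expr0n addr0.
Qed.

(** Take A = 1 + pi^(m-1) E_ij and B = 1 + pi E_jl, both 1 mod p since m > 1. The leading term is
    E_il, or E_ii - E_jj if l = i, which is nonscalar when 2 is nonzero in k. *)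
Lemma level_nonscalar_elem H m i j l : GL_subgroup H -> (1 < m)%N ->
  dense_mod (derived_gen H) m -> i != j -> l != j -> (l = i -> (2%:R : k) != 0) ->
  exists X : 'M[k]_n, level (derived_gen H) m X /\ ~ exists c, X = c%:M.
Proof.
case: m => [|[|m]] // HG _ dm ij lj l2; have jl : j != l by rewrite eq_sym.
have := @level_approx H m.+2 (elem_mx i j (pi ^+ m.+1)) (elem_mx j l pi)
  (delta_mx i l - delta_mx j j *+ (l == i)) HG isT dm.
rewrite !map_elem_mx rmorphXn /= red_pi expr0n /= !elem_mx0 !det_elem_mx //.
rewrite elem_mx_lie // -exprSr => /(_ erefl erefl erefl erefl erefl) lev.
eexists; split; first exact: lev.
move=> [c /matrixP e]; case: (eqVneq l i) e l2 => [->|li] e l2.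
  have := l2 erefl; have := e j j; have := e i i; rewrite !mxE !eqxx.
  rewrite [j == i]eq_sym (negPf ij) /= !mulr1n rmorphB rmorphB rmorph0 rmorph1 subr0 add0r.
  by move=> <- /eqP; rewrite eq_sym -addr_eq0 => /eqP e2; rewrite [2%:R](e2) eqxx.
have := e i l; rewrite mulr0n subr0 !mxE !eqxx [i == l]eq_sym (negPf li) rmorph1.
by move/eqP; rewrite mulr0n oner_eq0.
Qed.

Lemma char2_sub_inv m (t := 1 + pi ^+ m) : (2%:R : R) = 0 -> t \is a GRing.unit ->
  t - t^-1 = pi ^+ m.*2 / t.
Proof.
move=> R2 tu; apply: (mulIr tu); rewrite divrK // mulrBl mulVr // -muln2 exprM.
rewrite -[RHS]addr0 -(mul0r (pi ^+ m)) -R2 /t; ring.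
Qed.

(** The bracket of the torus element with 1 + pi E_ij is pi (t - t^-1) E_ij, which is pi^(2m+1) t^-1
    E_ij in characteristic 2. *)
Lemma level_nonscalar_char2_odd H m i j : GL_subgroup H -> (0 < m)%N ->
  dense_mod (derived_gen H) m.*2.+1 -> i != j -> (2%:R : R) = 0 ->
  exists X : 'M[k]_n, level (derived_gen H) m.*2.+1 X /\ ~ exists c, X = c%:M.
Proof.
move=> HG m0 dm ij R2; set t := 1 + pi ^+ m.
have rt : red t = 1 by apply: map_1_add_pi.
have tu : t \is a GRing.unit by apply: red_unit; rewrite rt oner_eq0.
have := @level_approx H m.*2.+1 (torus_mx i j t) (elem_mx i j pi)
  (t^-1 *: delta_mx i j) HG isT dm.
rewrite map_torus_mx // map_elem_mx red_pi elem_mx0 rt det_torus_mx // det_elem_mx //.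
rewrite torus_elem_lie // scalerA.
rewrite torus_mx1.
rewrite char2_sub_inv // mulrA -exprS.
move=> /(_ erefl erefl erefl erefl erefl) lev; eexists; split; first exact: lev.
apply: (@nonscalar_offdiag _ i j ij).
by rewrite map_mxZ map_delta_mx !mxE !eqxx rmorphV // rt invr1 mulr1 oner_eq0.
Qed.

(* Here B is not 1 mod p, so the error X in approximating the torus element contributes to
   the (i, j) entry b (1 + b X_ji).  As X does not depend on b, one can choose b so that
   this is nonzero. *)
Lemma level_nonscalar_char2_even H m i j : (9 < #|k|)%N -> GL_subgroup H -> (0 < m)%N ->
  dense_mod (derived_gen H) m.*2 -> i != j -> (forall l, l = i \/ l = j) ->
  (2%:R : R) = 0 ->
  exists X : 'M[k]_n, level (derived_gen H) m.*2 X /\ ~ exists c, X = c%:M.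
Proof.
move=> card_k HG m0 dm ij only R2; set t := 1 + pi ^+ m.
have m20 : (0 < m.*2)%N by rewrite double_gt0.
have rt : red t = 1 by apply: map_1_add_pi.
have tu : t \is a GRing.unit by apply: red_unit; rewrite rt oner_eq0.
have k2 : (2%:R : k) = 0 by rewrite -(rmorph_nat red) R2 rmorph0.
have rT : (torus_mx i j t)^r = 1%:M by rewrite map_torus_mx // rt torus_mx1.
have [a [Da /mx_congP [X eX]]] := dm _ (det_torus_mx ij tu).
have Ha := derived_gen_sub HG Da.
have ea : a = torus_mx i j t + pi ^+ m.*2 *: (- X) by rewrite eX scalerN addrK.
(* As a and the torus element both have determinant 1, X has trace 0 mod p; with n = 2 and
   characteristic 2 this equates the diagonal entries. *)
have trX : X^r i i = X^r j j.
  have eT : a = torus_mx i j t *m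
      (1%:M + pi ^+ m.*2 *: (invmx (torus_mx i j t) *m (- X))).
    by rewrite ea mulmxDr mulmx1 -scalemxAr mulKVmx // unitmxE det_torus_mx // unitr1.
  have := derived_gen_det HG Da; rewrite eT det_mulmx det_torus_mx // mul1r.
  move/(level_trace m20); rewrite map_mxM map_mx_red_inv; last first.
    by rewrite unitmxE det_torus_mx // unitr1.
  rewrite map_torus_mx // rt torus_mx1 invmx1 mul1mx map_mxN /mxtrace.
  rewrite (bigD1 i) //= (bigD1 j) ?[j == i]eq_sym //= big1 => [|l]; last first.
    by case: (only l) => ->; rewrite eqxx ?andbF.
  rewrite addr0 ![(- _ : 'M_n) _ _]mxE -opprD => /eqP; rewrite oppr_eq0 => /eqP e.
  have := congr1 (fun x => x + X^r j j) e; rewrite -addrA -mulr2n -[_ *+ 2]mulr_natl k2.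
  by rewrite mul0r addr0 add0r.
(* b avoids the roots of b (1 + b X_ji), where -1 = 1. If X_ji = 0, its inverse is 0 by convention
   and only b = 0 is excluded. *)
have [b] := @exists_notin k [:: 0; (X^r j i)^-1] (@leq_trans 10 3 _ isT card_k).
rewrite !inE negb_or => /andP[b0 bX].
have [b' rb] := red_surj b.
have [e [/(derived_gen_sub HG) He /mx_congP [Y eY]]] := dm _ (det_elem_mx b' ij).
have ee : e = elem_mx i j b' + pi ^+ m.*2 *: (- Y) by rewrite eY scalerN addrK.
have := @level_comm H m.*2 (torus_mx i j t) (elem_mx i j b') (- X) (- Y)
  ((b' / t) *: delta_mx i j) HG m20.
have tt : b' * (t - t^-1) = pi ^+ m.*2 * (b' / t) by rewrite char2_sub_inv // mulrCA.
rewrite torus_elem_lie // scalerA tt -ea -ee => /(_ erefl Ha He) lev.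
eexists; split; first exact: lev.
apply: (@nonscalar_offdiag _ i j ij).
have rB : (elem_mx i j b')^r = 1%:M + b *: delta_mx i j by rewrite map_elem_mx rb.
have rBV : invmx (elem_mx i j b')^r = 1%:M - b *: delta_mx i j.
  by rewrite map_elem_mx rb invmx_elem_mx // /elem_mx scaleNr.
rewrite rT mulmx1 rBV [X in _ + X + _](_ : _ = 0) ?addr0 ?rB; last first.
  by apply/eqP; rewrite subr_eq0 mul1mx; apply/eqP/esym/mulmx1.
rewrite map_mxZ map_delta_mx rmorphM rmorphV // rt rb invr1 mulr1.
have -> : (- X)^r = - X^r by rewrite map_mxN.
move: X^r trX bX => x trX bX; set W := (X in _ *m X).
have WE c d : W c d = b * ((c == i) && (d == j))%:R
    - (x c d + b * (x c i *+ (d == j))) + (x c d + b * (x j d *+ (c == i))).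
  rewrite /W mulNmx mulmxN opprK mulmxDr mulmx1 mulmxDl mul1mx -scalemxAl -scalemxAr.
  by rewrite addrA !(delta_mulmxE, mulmx_deltaE, mxE).
(* The entry to compute is W_ij - b W_jj; the equality of X_ii and X_jj cancels every term except b
   (1 + b X_ji). *)
clearbody W; rewrite mulmxBl mul1mx -scalemxAl !(delta_mulmxE, mulmx_deltaE, mxE) !WE.
rewrite !eqxx [j == i]eq_sym (negPf ij) /= !mulr1n !mulr0n trX.
have -> : b * 1 - (x i j + b * x j j) + (x i j + b * x j j) -
    b * (b * 0 - (x j j + b * x j i) + (x j j + b * 0)) = b * (1 + b * x j i) by ring.
rewrite mulf_neq0 //; apply: contraNneq bX => bx0.
have x0 : x j i != 0.
  by apply/eqP => x0; move/eqP: bx0; rewrite x0 mulr0 addr0 oner_eq0.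
apply/eqP/(mulIf x0); rewrite mulVf //; apply/eqP.
have /eqP := bx0; rewrite addrC addr_eq0 => /eqP ->.
by rewrite eq_sym -addr_eq0 -k2.
Qed.

(** * Density of the derived group in SL_n(R) *)

Lemma dense_mod_all H : (9 < #|k|)%N -> (2 <= n)%N -> [pchar R] =i [pchar k] ->
  GL_subgroup H -> SL_in_H0 red H -> H1_nonscalar pi H ->
  forall m, dense_mod (derived_gen H) m.
Proof.
move=> card_k n2 equichar HG H0 H1; have card3 : (3 < #|k|)%N by apply: leq_trans card_k.
pose i := Ordinal (ltnW n2); pose j := Ordinal n2; have ij : i != j by [].
have DG := derived_gen_GL HG; have D0 := derived_gen_level0 card3 HG H0.
have ns m : (0 < m)%N -> dense_mod (derived_gen H) m ->
    exists X : 'M[k]_n, level (derived_gen H) m X /\ ~ exists c, X = c%:M.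
  case: m => [|[|m]] // _ dm; first exact: (derived_gen_level1 ij).
  have [l /andP[li lj]|only_ij] := pickP (fun l => (l != i) && (l != j)).
    by apply: (level_nonscalar_elem HG _ dm ij lj) => // el; rewrite el eqxx in li.
  have only l : l = i \/ l = j.
    have := only_ij l; case: eqVneq => [|_]; first by left.
    by move=> /negbFE/eqP; right.
  have [k2|k2] := eqVneq (2%:R : k) 0; last exact: (level_nonscalar_elem HG _ dm ij ij).
  (* Equal characteristic carries 2 = 0 from k to R. *)
  have R2 : (2%:R : R) = 0.
    have : 2 \in [pchar R] by rewrite equichar inE /= k2 eqxx.
    by rewrite inE => /andP[_ /eqP].
  have := odd_double_half m.+2; have : (0 < m.+2./2)%N by [].
  move: (m.+2./2) => h h0; case: (odd _) => em; move: dm; rewrite -em ?add1n ?add0n => dm.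
    exact: (level_nonscalar_char2_odd HG h0 dm ij R2).
  exact: (level_nonscalar_char2_even card_k HG h0 dm ij only R2).
elim=> [|m IHm] A detA.
  exists 1%:M; split; first exact: dg_one.
  by apply/mx_congP; exists (A - 1%:M); rewrite expr0 scale1r addrC subrK.
case: (posnP m) => [->|m0].
  have detAr : \det A^r = 1 by rewrite det_map_mx detA rmorph1.
  have [B [DB rB]] := D0 _ detAr; exists B; split=> //; apply/mx_congP.
  have [Y eY] : exists Y, A - B = pi *: Y.
    by apply: map_mx_red_ker; rewrite map_mxB rB subrr.
  by exists Y; rewrite expr1 -eY addrC subrK.
have [B [DB /mx_congP [Y eY]]] := IHm A detA.
have uB : B \in unitmx by case: DG => _ DU _ _; apply: DU.
(* The remaining factor 1 + pi^m B^-1 Y has determinant 1, so its leading term has trace 0 and is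
   the leading term of an element of D; multiplying B by that element improves the approximation to
   p^(m+1). *)
have eA : A = B *m (1%:M + pi ^+ m *: (invmx B *m Y)).
  by rewrite mulmxDr mulmx1 -scalemxAr mulKVmx.
have trY : \tr (invmx B *m Y)^r = 0.
  by move: detA; rewrite eA det_mulmx (derived_gen_det HG DB) mul1r => /(level_trace m0).
have [X [levX nsX]] := ns m m0 IHm.
have [W [DW rW]] := level_nonscalar_all card3 DG D0 m0 levX nsX trY.
have [Z eZ] : exists Z, invmx B *m Y - W = pi *: Z.
  by apply: map_mx_red_ker; rewrite map_mxB rW subrr.
exists (B *m (1%:M + pi ^+ m *: W)); split; first exact: dg_mul.
apply/mx_congP; exists (B *m Z); rewrite {1}eA -[invmx B *m Y](subrK W) eZ.
by rewrite scalemxAr -mulmxDr scalerDr scalerA -exprSr addrA addrAC.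
Qed.

(** The determinant is continuous and equals 1 on the derived group; the powers of p intersect in
    0. *)
Lemma Hder_det H A : GL_subgroup H -> Hder pi H A -> \det A = 1.
Proof.
move=> HG AH; apply/eqP; rewrite -subr_eq0; apply/eqP/pmul_eq0 => m.
have [B [DB /mx_congP [Y ->]]] := AH m; have detB := derived_gen_det HG DB.
have uB : B \in unitmx by rewrite unitmxE detB unitr1.
have -> : B + pi ^+ m *: Y = B *m (1%:M + pi ^+ m *: (invmx B *m Y)).
  by rewrite mulmxDr mulmx1 -scalemxAr mulKVmx.
have [z] := det_1_add_scale (pi ^+ m) (invmx B *m Y).
rewrite det_mulmx detB mul1r => ->.
by exists (\tr (invmx B *m Y) + pi ^+ m * z); ring.
Qed.

End Reduction.

Theorem mainTheorem14
  (R : idomainType) (pi : R) (k : finFieldType) (red : {rmorphism R -> k})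
  (hdvr : DVR_uniformizer pi) (hcomplete : p_complete pi)
  (hred_surj : forall c : k, exists x : R, red x = c)
  (hred_ker : forall x : R, red x = 0 <-> pmul pi 1 x)
  (hequichar : [pchar R] =i [pchar k])
  (hk : (9 < #|k|)%N)
  (n : nat) (hn : (2 <= n)%N)
  (H : 'M[R]_n -> Prop) (hH : GL_subgroup H) (hclosed : mx_closed pi H)
  (hH0 : SL_in_H0 red H) (hH1 : H1_nonscalar pi H) :
  forall A : 'M[R]_n, Hder pi H A <-> \det A = 1.
Proof.
move=> A; split; first exact: Hder_det.
move=> detA m; exact: (dense_mod_all hdvr hred_surj hred_ker hk hn hequichar hH hH0 hH1).
Qed.
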